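(* Let $\mu = -\alpha_{i,j}$ with $1 < i \leq j < r$ be a negative root of $\mathfrak{sl}_{r+1}(\mathbb{C})$ and let $\tilde\alpha$ be the highest root. The set $\mathrm{BAS}(\tilde\alpha, \mu)$ of basic allowable subwords of $\mathcal{A}(\tilde\alpha, \mu)$ consists of (a) $s_k$ with $1 < k < r$, (b) $s_{k+1}s_k$ with $\max(i-1,2) \leq k \leq j-1$, (c) $s_ks_{k+1}$ with $i \leq k \leq \min(j,r-2)$, (d) $s_ks_{k+1}s_k$ with $i \leq k \leq j-1$, and (e) $s_{k+2}s_ks_{k+1}$ with $i \leq k \leq j-2$.
   Context: Type $A_r$: the simple roots are $\alpha_i=e_i-e_{i+1}\in\mathbb{R}^{r+1}$ for $1\le i\le r$; the positive roots are $\alpha_{i,j}=\alpha_i+\alpha_{i+1}+\cdots+\alpha_j$ for $1\le i\le j\le r$; the highest root is $\tilde\alpha=\alpha_1+\cdots+\alpha_r$; $\rho$ is half the sum of the positive roots. The Weyl group $W\cong\mathfrak{S}_{r+1}$ is generated by the simple reflections $s_1,\dots,s_r$, where $s_k$ swaps $e_k$ and $e_{k+1}$. $\wp(\xi)$ is the number of ways of expressing $\xi$ as a linear combination of positive roots with nonnegative integer coefficients, and $\mathcal{A}(\lambda,\mu)=\{\sigma\in W:\wp(\sigma(\lambda+\rho)-\mu-\rho)>0\}$. The influence of $\sigma\in W$ is $I(\sigma)=\{i: s_i\text{ is in a reduced word for }\sigma\}$ and the extended influence is $\overline I(\sigma)=\{i: i\in I(\sigma) \text{ or } i+1\in I(\sigma)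 \text{ or } i-1\in I(\sigma)\}$. $I(\sigma)$ is connected if it induces a connected subgraph of the Dynkin diagram (the path $1-2-\cdots-r$), i.e. it is a set of consecutive integers. $\sigma,\tau$ are independent if $I(\sigma)\cap\overline I(\tau)=\emptyset$; a set is pairwise independent if any two distinct elements of it are independent. For $\lambda$ dominant integral and $\mathcal{A}(\lambda,\mu)\neq\emptyset$, $\mathrm{BAS}(\lambda,\mu)$ (the basic allowable subwords) is the unique subset $S\subseteq\mathcal{A}(\lambda,\mu)$ with $1\notin S$ such that each $b\in S$ has connected influence and every $\sigma\in\mathcal{A}(\lambda,\mu)$ is a product of the elements of a (possibly empty) pairwise independent subset of $S$. *)

(* Defs.v *)
From HB Require Import structures.
From mathcomp Require Import all_boot all_order all_algebra all_fingroup.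
From mathcomp Require Import finmap.
From mathcomp Require Import boolp classical_sets cardinality reals.

Set Implicit Arguments.
Unset Strict Implicit.
Unset Printing Implicit Defensive.

Import Order.TTheory GRing.Theory Num.Theory.
Local Open Scope classical_set_scope.
Local Open Scope ring_scope.

(* Indices of simple roots, simple reflections and Dynkin diagram vertices are
   natural numbers k with 1 <= k <= r; values outside that range are junk. *)

Section Roots.
Variables (R : realType) (r : nat).
Implicit Types (lambda mu xi : 'cV[R]_r.+1).

(* The standard basis vector e_k of R^(r+1), 1 <= k <= r+1. *)
Definition stdvec (k : nat) : 'cV[R]_r.+1 := \col_m (m.+1 == k)%:R.

Definition simple_root (k : nat) : 'cV[R]_r.+1 := stdvec k - stdvec k.+1.

Definition alpha (i j : nat) : 'cV[R]_r.+1 :=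
  \sum_(i <= k < j.+1) simple_root k.

(* The pair (a, b) stands for the positive root alpha_{a+1,b+1}. *)
Definition posroot := {p : 'I_r * 'I_r | (p.1 <= p.2)%N}.

Definition posroot_vec (p : posroot) : 'cV[R]_r.+1 :=
  alpha (val p).1.+1 (val p).2.+1.

Definition highest_root : 'cV[R]_r.+1 := alpha 1 r.

Definition rho : 'cV[R]_r.+1 := 2%:R^-1 *: \sum_(p : posroot) posroot_vec p.

Definition partitions xi : set {ffun posroot -> nat} :=
  [set c | \sum_(p : posroot) posroot_vec p *+ c p = xi].

(* fset_set is junk on infinite sets; see finite_partitions below. *)
Definition kostant xi : nat := #|` fset_set (partitions xi)|%fset.

(* W is 'S_r.+1 acting on the left by permutation matrices. Since perm_mx is
   multiplicative, s * t acts as "t first, then s", which is the usual reading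
   of products in W (as a map on indices, s * t in MathComp is t \o s). *)
Definition weyl_act (s : 'S_r.+1) (v : 'cV[R]_r.+1) : 'cV[R]_r.+1 :=
  perm_mx s *m v.

Definition alternation lambda mu : set 'S_r.+1 :=
  [set s | (0 < kostant (weyl_act s (lambda + rho) - mu - rho))%N].

End Roots.

Section Weyl.
Variable r : nat.
Implicit Types (s t : 'S_r.+1) (w : seq nat).

Definition srefl (k : nat) : 'S_r.+1 := tperm (inord k.-1) (inord k).

Definition vertex (k : nat) : bool := (1 <= k <= r)%N.

Definition word_for w s : Prop :=
  all vertex w /\ (\prod_(k <- w) srefl k)%g = s.

Definition reduced_word w s : Prop :=
  word_for w s /\ forall w', word_for w' s -> (size w <= size w')%N.

Definition influence s : set nat :=
  [set k | exists2 w, reduced_word w s & k \in w].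

Definition extended_influence s : set nat :=
  [set k | vertex k /\
    [\/ influence s k, influence s k.+1 | influence s k.-1]].

Definition dynkin_edge (k l : nat) : bool := (k.+1 == l) || (l.+1 == k).

(* The subgraph of the Dynkin diagram induced by K is connected. *)
Definition dynkin_connected (K : set nat) : Prop :=
  forall a b, K a -> K b ->
  exists p : seq nat,
    [/\ path dynkin_edge a p, last a p = b & forall c, c \in p -> K c].

Definition independent s t : Prop :=
  influence s `&` extended_influence t = set0.

Definition pairwise_independent (T : {set 'S_r.+1}) : Prop :=
  forall s t, s \in T -> t \in T -> s != t -> independent s t.

End Weyl.

(* Independent elements commute, so the product over T does not depend on the
   order of enumeration. *)
Definition is_BAS (R : realType) (r : nat) (lambda mu : 'cV[R]_r.+1)
    (S : set 'S_r.+1) : Prop :=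
  [/\ S `<=` alternation lambda mu,
      ~ S 1%g,
      forall b, S b -> dynkin_connected (influence b)
    & forall s, alternation lambda mu s ->
        exists T : {set 'S_r.+1},
          [/\ (forall t, t \in T -> S t), pairwise_independent T
            & s = (\prod_(t in T) t)%g]].

Section Finiteness.
Variables (R : realType) (r : nat).

(* Minus the pairing with (1, 2, ..., r+1): it sends each simple root to 1. *)
Let height (v : 'cV[R]_r.+1) : R := - \sum_(m < r.+1) v m 0 *+ m.+1.

Let heightD : {morph height : u v / u + v}.
Proof.
move=> u v; rewrite /height -opprD -big_split /=.
by congr (- _); apply: eq_bigr => m _; rewrite mxE mulrnDl.
Qed.

Let height0 : height 0 = 0.
Proof. by rewrite /height big1 ?oppr0 // => m _; rewrite mxE mul0rn. Qed.

Let heightMn v n : height (v *+ n) = height v *+ n.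
Proof.
elim: n => [|n IHn]; first by rewrite !mulr0n height0.
by rewrite !mulrS heightD IHn.
Qed.

Let height_simple k : (1 <= k <= r)%N -> height (simple_root R r k) = 1.
Proof.
case/andP=> k1 kr.
have h1 (l : nat) : (1 <= l <= r.+1)%N ->
    \sum_(m < r.+1) (stdvec R r l) m 0 *+ m.+1 = l%:R.
  case: l => // l /= lr; rewrite (bigD1 (Ordinal lr)) //= mxE eqxx big1 ?addr0 //.
  by move=> m; rewrite mxE eqSS -val_eqE /= => /negPf ->; rewrite mul0rn.
rewrite /height /simple_root.
under eq_bigr => m _ do rewrite mxE [X in _ + X]mxE mulrnDl mulNrn.
rewrite big_split /= sumrN !h1 ?k1 ?ltnS //; last by rewrite (leq_trans kr).
by rewrite -addn1 natrD opprB addrC addKr.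
Qed.

Let height_posroot (p : posroot r) :
  height (posroot_vec R p) = ((val p).2.+1 - (val p).1)%N%:R.
Proof.
rewrite /posroot_vec /alpha (big_morph _ heightD height0).
rewrite big_nat_cond (eq_bigr (fun=> 1)) => [|k].
  by rewrite -big_nat_cond sumr_const_nat subSS.
rewrite andbT => /andP[k1 k2]; apply: height_simple.
by rewrite (leq_trans _ k1) //= (leq_trans _ (ltn_ord (val p).2)).
Qed.

Lemma finite_partitions (xi : 'cV[R]_r.+1) : finite_set (partitions xi).
Proof.
have [->|/set0P[c0 c0P]] := eqVneq (partitions xi) set0.
  exact: finite_set0.
pose wt (c : {ffun posroot r -> nat}) :=
  (\sum_(p : posroot r) ((val p).2.+1 - (val p).1) * c p)%N.
have wtE c : partitions xi c -> (wt c)%:R = height xi.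
  move=> <-; rewrite (big_morph _ heightD height0) natr_sum.
  by apply: eq_bigr => p _; rewrite heightMn height_posroot natrM mulr_natr.
pose N := wt c0.
pose f (g : {ffun posroot r -> 'I_N.+1}) : {ffun posroot r -> nat} :=
  [ffun p => nat_of_ord (g p)].
apply: (@sub_finite_set _ _ (f @` setT)); last first.
  by apply: finite_image; exact: finite_finset.
move=> c cP; have cN p : (c p < N.+1)%N.
  have wtc : wt c = N by apply/eqP; rewrite -(eqr_nat R) (wtE c) // -(wtE c0).
  rewrite ltnS -wtc /wt (bigD1 p) //= (leq_trans _ (leq_addr _ _)) //.
  by rewrite leq_pmull // subn_gt0 ltnS (valP p).
exists [ffun p => Ordinal (cN p)] => //.
by apply/ffunP => p; rewrite !ffunE.
Qed.

End Finiteness.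

(* Main.v *)
Require Import Defs.
From HB Require Import structures.
From mathcomp Require Import all_boot all_order all_algebra all_fingroup.
From mathcomp Require Import zify ring finmap.
From mathcomp Require Import boolp classical_sets cardinality reals.

Set Implicit Arguments.
Unset Strict Implicit.
Unset Printing Implicit Defensive.

Import Order.TTheory GRing.Theory Num.Theory.
Local Open Scope classical_set_scope.
Local Open Scope ring_scope.

(** Write a permutation [s] of the positions [0, .., r] and let
    [displacement s m] be the sum of [s x - x] over [x < m].  The coefficients of
    [s (lambda + rho) - mu - rho] on the simple roots are its partial sums of
    coordinates, and a vector is a nonnegative integral combination of positive
    roots iff its coordinates add up to [0] and these partial sums are
    nonnegative integers ([kostant_partial_sums]).  For the highest root and
    [mu = - alpha_{i,j}] this says that [s] fixes both ends and that
    [displacement s m <= 1 + [i <= m <= j]] for every [m]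
    ([alternation_displacement]).

    Such permutations can be classified by hand.  The displacement vanishes at
    [m] exactly when [s] preserves the positions below [m]; between two
    consecutive zeros the bound [2] leaves, apart from a fixed point and up to
    translation, only the five blocks 10, 120, 201, 210 and 2031
    ([first_block]).  These are the five
    products of simple reflections of the theorem, and evaluating the bound on
    their displacements gives the stated ranges of [k].  Removing the leftmost block
    of [s] leaves an element of the alternation set
    that fixes more initial positions ([peel_block]), so [s] is a product of
    independent blocks ([allowable_decomposition]).

    The link with influences is that [k] occurs in a reduced word of [s] iff [s]
    moves some position across the cut between [k - 1] and [k]
    ([influenceE]), which rests on the exchange property of words.  A product of
    pairwise independent elements then acts as the disjoint union of its
    factors, its influence is the union of theirs, and it is disconnected as
    soon as there are two nontrivial factors.  Hence every set of basic allowable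
    subwords is the set of all nontrivial elements of the alternation set with
    connected influence ([BAS_connected]), which gives uniqueness. *)

(** * Permutations acting on natural numbers, and crossed cuts *)

Section Permutations.
Variable r : nat.
Implicit Types (s t : 'S_r.+1) (w : seq nat) (m n k l : nat).

(** Extended by the identity beyond [r], so that the action is a bijection of
    the natural numbers and positions need no range conditions. *)
Definition natact s n : nat := if (n <= r)%N then s (inord n) : nat else n.

Lemma natact_ord s (x : 'I_r.+1) : natact s x = s x.
Proof. by rewrite /natact -ltnS ltn_ord inord_val. Qed.

Lemma natact_out s n : (r < n)%N -> natact s n = n.
Proof. by rewrite /natact ltnNge; case: leqP. Qed.

Lemma natact_le s n : (natact s n <= r)%N = (n <= r)%N.
Proof. by rewrite /natact; case: (leqP n r) => h; first exact: leq_ord; rewrite leqNgt h. Qed.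

Lemma natact1 n : natact 1 n = n.
Proof. by rewrite /natact; case: leqP => h //; rewrite perm1 inordK. Qed.

Lemma natactM s t n : natact (s * t)%g n = natact t (natact s n).
Proof.
have [h|h] := leqP n r; last by rewrite !natact_out // natact_out.
by rewrite -(inordK (h : (n < r.+1)%N)) !natact_ord permM.
Qed.

Lemma natactK s n : natact s^-1%g (natact s n) = n.
Proof. by rewrite -natactM mulgV natact1. Qed.

Lemma natactKV s n : natact s (natact s^-1%g n) = n.
Proof. by rewrite -natactM mulVg natact1. Qed.

Lemma natact_inj s : injective (natact s).
Proof. exact: can_inj (natactK s). Qed.

Lemma natactV_fix s n : natact s n = n -> natact s^-1%g n = n.
Proof. by move=> h; rewrite -{1}h natactK. Qed.

Lemma eq_natact s t : natact s =1 natact t -> s = t.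
Proof. by move=> h; apply/permP=> x; apply: val_inj; rewrite /= -!natact_ord h. Qed.

Lemma natact_srefl k n : vertex r k ->
  natact (srefl r k) n = if n == k.-1 then k else if n == k then k.-1 else n.
Proof.
move=> /andP[k1 kr]; rewrite /natact; case: leqP => h; last by do 2?case: ifP; lia.
rewrite /srefl; case: tpermP => [/(congr1 val)|/(congr1 val)|].
- rewrite /= !inordK; try lia; move=> ->; rewrite eqxx; lia.
- rewrite /= !inordK; try lia; move=> ->; rewrite eqxx; case: eqP; lia.
move=> /eqP; rewrite -val_eqE /= !inordK; try lia.
move=> /negPf-> /eqP; rewrite -val_eqE /= !inordK; try lia.
by move=> /negPf->.
Qed.

(** With positions counted from [0], the vertex [k] of the Dynkin diagram is the
    cut between the positions [k - 1] and [k]. *)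
Definition crosses s k : Prop := exists2 n, (n < k)%N & (k <= natact s n)%N.

(** A position that comes down across the cut forces another one to go up,
    because an injective map of the finite segment below [k] into itself is
    onto. *)
Lemma crosses_back s k n : (k <= n)%N -> (natact s n < k)%N -> crosses s k.
Proof.
move=> kn snk; apply: contrapT => nc.
have stab m : (m < k)%N -> (natact s m < k)%N.
  by move=> mk; rewrite ltnNge; apply/negP => km; apply: nc; exists m.
have nr : (n <= r)%N.
  by rewrite leqNgt; apply/negP => rn; move: snk; rewrite natact_out //; lia.
pose A := [set x : 'I_r.+1 | (x < k)%N]%SET.
have sA : (s @: A)%SET = A.
  apply/eqP; rewrite eqEcard card_imset ?leqnn ?andbT; last exact: perm_inj.
  apply/fintype.subsetP => _ /imsetP[x + ->]; rewrite !inE => xk.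
  by rewrite -natact_ord stab.
have : s (inord n) \in A by rewrite inE -natact_ord inordK.
rewrite -{1}sA mem_imset; last exact: perm_inj.
by rewrite inE inordK //; lia.
Qed.

Lemma crosses_vertex s k : crosses s k -> vertex r k.
Proof.
move=> [n nk ksn]; rewrite /vertex; apply/andP; split; first lia.
have [h|h] := leqP n r; first by move: h; rewrite -(natact_le s); lia.
by move: ksn; rewrite natact_out //; lia.
Qed.

Lemma moved_crosses s n : natact s n != n -> crosses s n \/ crosses s n.+1.
Proof.
rewrite neq_ltn => /orP[h|h]; last by right; exists n.
by left; apply: (@crosses_back s n n).
Qed.

Lemma nontrivial_crosses s : s <> 1%g -> exists k, crosses s k.
Proof.
move=> s1; apply: contrapT => nc; apply: s1; apply: eq_natact => n.
rewrite natact1; apply/eqP; apply: contrapT => /negP /moved_crosses h.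
by apply: nc; case: h => h; eexists; exact: h.
Qed.

(** * Reduced words *)

Local Notation wprod w := (\prod_(k <- w) srefl r k)%g.

Lemma natact_wprod_lt k w n : all (vertex r) w -> k \notin w ->
  (natact (wprod w) n < k)%N = (n < k)%N.
Proof.
elim: w n => [|l w IH] n /=; first by rewrite big_nil natact1.
move=> /andP[lr wr]; rewrite inE negb_or => /andP[kl kw].
rewrite big_cons natactM IH // natact_srefl //.
move: lr kl; rewrite /vertex => /andP[? ?] /eqP ?.
by case: eqP => [|?]; last case: eqP; lia.
Qed.

(** The wires starting at [a < b] arrive crossed and [k] would cross them again;
    deleting [k] together with a letter at which they crossed
    leaves the product unchanged. *)
Lemma exchange w (a b k : nat) :
  all (vertex r) w -> vertex r k -> (a < b)%N ->
  natact (wprod w) a = k -> natact (wprod w) b = k.-1 ->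
  exists w', word_for w' (wprod w * srefl r k)%g /\ (size w' < size w)%N.
Proof.
elim: w a b => [|l w IH] a b.
  by rewrite big_nil !natact1 /vertex => _ ? ? ? ?; exfalso; lia.
move=> /= /andP[lr wr] kr ab; rewrite big_cons !natactM => Ha Hb.
have [lt|ge] := ltnP (natact (srefl r l) a) (natact (srefl r l) b).
  have [w' [[w'r w'E] sw']] := IH _ _ wr kr lt Ha Hb.
  exists (l :: w'); split; last by [].
  by split; [rewrite /= lr | rewrite big_cons w'E mulgA].
have [Ea Eb] : a = l.-1 /\ b = l.
  move: ge; rewrite !natact_srefl //; move: lr; rewrite /vertex => /andP[? ?].
  by do 4?[case: eqP => ?]; lia.
exists w; split; last by [].
split=> //; set q := (\prod_(_ <- _) _)%g in Ha Hb *.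
have /andP[l1 l2] := lr; have /andP[k1 k2] := kr.
(* The letter [l] conjugated through the rest of the word is [k]. *)
have EJ : (srefl r l ^ q)%g = srefl r k.
  rewrite /srefl tpermJ; congr tperm; apply: val_inj; rewrite /= -natact_ord !inordK; try lia.
    rewrite -Hb Eb; congr natact.
    by rewrite natact_srefl // eqxx; case: eqP; lia.
  by rewrite -Ha Ea; congr natact; rewrite natact_srefl // eqxx.
by rewrite -EJ -mulgA -conjgC mulgA /srefl tperm2 mul1g.
Qed.

Lemma reduced_prefix u v w' s : reduced_word (u ++ v) s ->
  word_for w' (wprod u) -> (size u <= size w')%N.
Proof.
move=> [[uvr uvE] min] [w'r w'E]; move: uvr; rewrite all_cat => /andP[ur vr].
have := min (w' ++ v); rewrite !size_cat leq_add2r; apply.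
by split; [rewrite all_cat w'r | rewrite big_cat /= w'E -uvE big_cat].
Qed.

(** Two wires that cross twice in a word allow it to be shortened by [exchange],
    so in a reduced word an inversion of a prefix is never undone. *)
Lemma inversion_persists u v s (a b : nat) : reduced_word (u ++ v) s ->
  (a < b)%N -> (natact (wprod u) b < natact (wprod u) a)%N ->
  (natact s b < natact s a)%N.
Proof.
elim: v u => [|k v IH] u; first by rewrite cats0 => -[[_ <-] _].
rewrite -cat_rcons => red ab inv; apply: (IH _ red) => //.
have kvr : all (vertex r) (rcons u k).
  by have [[+ _] _] := red; rewrite all_cat => /andP[].
move: kvr; rewrite all_rcons => /andP[kr ur].
rewrite big_rcons /= !natactM; move: inv.
set ua := natact _ a; set ub := natact _ b.
have [|] := boolP ((ua == k) && (ub == k.-1)).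
  move=> /andP[/eqP Ea /eqP Eb] _.
  have [w' [w'E sw']] := exchange ur kr ab Ea Eb.
  have := @reduced_prefix (rcons u k) v w' s red.
  by rewrite big_rcons size_rcons => /(_ w'E); lia.
have /andP[k1 k2] := kr.
by rewrite !natact_srefl //; do 4?[case: eqP => /= ?]; lia.
Qed.

Lemma word_tperm (x n : nat) : (x + n <= r)%N ->
  exists w, word_for w (tperm (inord x) (inord (x + n)) : 'S_r.+1).
Proof.
elim: n => [|n IH] h.
  by exists [::]; split=> //; rewrite big_nil addn0 tperm1.
have vr : vertex r (x + n.+1) by rewrite /vertex; lia.
have [->|n0] := eqVneq n 0%N.
  exists [:: x.+1]; split; rewrite /= ?big_seq1; first by rewrite /vertex; lia.
  by rewrite /srefl addn1.
have [|w [wr wE]] := IH; first lia.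
exists ((x + n.+1)%N :: rcons w (x + n.+1)%N); split; first by rewrite /= all_rcons vr wr.
rewrite big_cons big_rcons /= wE.
set p := srefl r _.
have -> : tperm (inord x) (inord (x + n.+1)) = (tperm (inord x) (inord (x + n)) ^ p)%g.
  rewrite tpermJ; congr tperm; apply: val_inj;
    rewrite /= -natact_ord natact_srefl // !inordK; try lia;
    do ?case: eqP; lia.
by rewrite /conjg /p /srefl tpermV.
Qed.

Lemma word_exists s : exists w, word_for w s.
Proof.
have wt (x y : 'I_r.+1) : exists w, word_for w (tperm x y).
  wlog xy : x y / (x <= y)%N.
    move=> H; case: (leqP x y) => [/H //|/ltnW /H]; by rewrite tpermC.
  have [|w] := @word_tperm x (y - x).
    by rewrite subnKC // -ltnS.
  by rewrite subnKC // !inord_val => H; exists w.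
have [ts -> _] := prod_tpermP s.
elim: ts => [|[x y] ts [w [wr wE]]]; first by exists [::]; rewrite /word_for !big_nil.
have [u [ur uE]] := wt x y.
exists (u ++ w); split; first by rewrite all_cat ur.
by rewrite big_cat big_cons /= uE wE.
Qed.

Lemma reduced_word_exists s : exists w, reduced_word w s.
Proof.
pose P n := `[< exists2 w, word_for w s & size w = n >].
have exP : exists n, P n.
  by have [w wE] := word_exists s; exists (size w); apply/asboolP; exists w.
case: (ex_minnP exP) => n /asboolP[w wE <-] min.
by exists w; split=> // w' w'E; apply: min; apply/asboolP; exists w'.
Qed.

(** Letters other than [k] preserve the positions before the cut.
    Conversely, the first occurrence of [k] in a reduced word makes two wires
    cross the cut, and they stay inverted to the end, so they cannot both be
    back on their own sides. *)
Lemma influenceE s k : influence s k <-> crosses s k.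
Proof.
split=> [[w red]|cr]; last first.
  have [w red] := reduced_word_exists s.
  exists w => //; apply: contrapT => /negP kw.
  have [[wr wE] _] := red; have [n nk] := cr.
  by rewrite -wE leqNgt natact_wprod_lt // nk.
move=> kw; move: (red); rewrite -[w](cat_take_drop (index k w)).
have -> : drop (index k w) w = k :: drop (index k w).+1 w.
  by rewrite -{2}(nth_index k kw) -drop_nth // index_mem.
(* [u] is the part of the word before the first occurrence of [k]. *)
set u := take _ _ => {}red.
have ku : k \notin u.
  by apply/negP => /index_ltn; rewrite ltnn.
have [[+ _] _] := red.
rewrite all_cat /= => /and3P[ur kr _].
have /andP[k1 k2] := kr.
pose p := wprod u; pose a := natact p^-1%g k.-1; pose b := natact p^-1%g k.
have pa : natact p a = k.-1 by rewrite natactKV.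
have pb : natact p b = k by rewrite natactKV.
have ak : (a < k)%N by rewrite -(natact_wprod_lt a ur ku) -/p pa; lia.
have kb : (k <= b)%N by rewrite leqNgt -(natact_wprod_lt b ur ku) -/p pb; lia.
move: red; rewrite -cat_rcons => /inversion_persists /(_ (leq_trans ak kb)).
rewrite big_rcons /= !natactM -/p pa pb !natact_srefl // !eqxx.
have -> : (k == k.-1) = false by lia.
have -> : (k.-1 < k)%N by lia.
move=> /(_ isT) inv.
have [ksa|sak] := leqP k (natact s a); first by exists a.
by apply: (crosses_back kb); lia.
Qed.

End Permutations.

(** * Products of independent elements *)

Section IndependentProducts.
Variable r : nat.
Implicit Types (s t : 'S_r.+1) (T : {set 'S_r.+1}) (m n k l : nat).

Lemma dynkin_edge_sym k l : dynkin_edge k l = dynkin_edge l k.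
Proof. by rewrite /dynkin_edge orbC. Qed.

Lemma crosses_extended s t k l : independent s t ->
  crosses s k -> crosses t l -> (k == l) || dynkin_edge k l -> False.
Proof.
move=> ind sk tl kl.
suff : (influence s `&` extended_influence t) k by rewrite ind.
split; first exact/influenceE.
split; first exact: crosses_vertex sk.
have /andP[l1 _] := crosses_vertex tl; move/influenceE: tl => tl.
case/orP: kl => [/eqP->|/orP[|] /eqP E]; first by constructor 1.
- by constructor 2; rewrite E.
by constructor 3; rewrite -E.
Qed.

(** A moved position [n] forces a crossing at the cut [n] or [n + 1], and these
    two vertices are equal or adjacent. *)
Lemma independent_support s t n : independent s t ->
  natact s n = n \/ natact t n = n.
Proof.
move=> ind; have [->|sn] := eqVneq (natact s n) n; first by left.
have [->|tn] := eqVneq (natact t n) n; first by right.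
case: (moved_crosses sn) => sc; case: (moved_crosses tn) => tc;
  by case: (crosses_extended ind sc tc); rewrite /dynkin_edge !eqxx ?orbT.
Qed.

Lemma natact_prod_fixed T n : (forall t, t \in T -> natact t n = n) ->
  natact (\prod_(t in T) t)%g n = n.
Proof.
move=> fixn; apply: (big_ind (fun s => natact s n = n)) => //; first exact: natact1.
by move=> s t sn tn; rewrite natactM sn.
Qed.

(** The factors have disjoint supports, so those other than [t] fix both [n]
    and its image under [t]; the order of the factors is immaterial. *)
Lemma natact_prod_moved T t n : pairwise_independent T -> t \in T ->
  natact t n != n -> natact (\prod_(t in T) t)%g n = natact t n.
Proof.
move=> ind tT tn; rewrite -big_filter.
set l := filter _ _.
have memT u : (u \in l) = (u \in T) by rewrite mem_filter mem_index_enum andbT.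
have: uniq l by rewrite filter_uniq ?index_enum_uniq.
have: t \in l by rewrite memT.
have disj u m : u \in l -> u != t -> natact t m != m -> natact u m = m.
  rewrite memT => uT ut /eqP tm.
  by case: (independent_support m (ind _ _ uT tT ut)).
elim: {memT} l disj => // u l IH disj; rewrite inE big_cons natactM => tul /= /andP[ul Ul].
have [ut|ut] := eqVneq u t; last first.
  rewrite (disj u n) ?mem_head //; apply: IH => //.
    by move=> v m vl; apply: disj; rewrite inE vl orbT.
  by move: tul; rewrite eq_sym (negPf ut).
subst u; rewrite big_seq.
apply: (big_ind (fun s => natact s (natact t n) = natact t n)); first exact: natact1.
  by move=> s v sn vn; rewrite natactM sn.
move=> v vl; apply: disj; first by rewrite inE vl orbT.
  by apply: contraNneq ul => <-.
by rewrite (inj_eq (@natact_inj r t)).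
Qed.

Lemma crosses_prod T k : pairwise_independent T ->
  crosses (\prod_(t in T) t)%g k <-> exists2 t, t \in T & crosses t k.
Proof.
move=> ind; split=> [[n nk ks]|[t tT [n nk kt]]]; last first.
  by exists n => //; rewrite (natact_prod_moved ind tT) //; apply/eqP; lia.
apply: contrapT => nt; suff : natact (\prod_(t in T) t)%g n = n by lia.
apply: natact_prod_fixed => t tT; apply/eqP; apply: contrapT => /negP tn.
by apply: nt; exists t => //; exists n; rewrite // -(natact_prod_moved ind tT).
Qed.

(** The influence of the product is the union of those of the factors.  A path
    in it cannot leave the influence of [t]: its first vertex outside would lie
    in the influence of another factor and in the extended influence of [t]. *)
Lemma connected_factor T t : pairwise_independent T ->
  (forall u, u \in T -> u <> 1%g) ->
  dynkin_connected (influence (\prod_(u in T) u)%g) -> t \in T ->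
  (\prod_(u in T) u)%g = t.
Proof.
move=> ind T1 conn tT; apply: eq_natact => n.
have [a ta] := nontrivial_crosses (T1 _ tT).
have only u : u \in T -> u = t.
  move=> uT; apply: contrapT => /eqP ut.
  have [b ub] := nontrivial_crosses (T1 _ uT).
  have infT v k : v \in T -> crosses v k -> influence (\prod_(u in T) u)%g k.
    by move=> vT vk; apply/influenceE/crosses_prod => //; exists v.
  have [p [pp lp pI]] := conn a b (infT t a tT ta) (infT u b uT ub).
  suff tb : crosses t b.
    by apply: (crosses_extended (ind _ _ uT tT ut) ub tb); rewrite eqxx.
  elim: p a ta pp lp pI => [|c p IH] a ta /=; first by move=> _ <-.
  move=> /andP[ac pp] lp pI; apply: (IH c) => //; last first.
    by move=> d dp; apply: pI; rewrite inE dp orbT.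
  have /influenceE /(crosses_prod _ ind)[v vT vc] := pI c (mem_head _ _).
  have [<-//|tv] := eqVneq v t.
  exfalso; apply: (crosses_extended (ind _ _ vT tT tv) vc ta).
  by rewrite dynkin_edge_sym ac orbT.
have [tn|tn] := eqVneq (natact t n) n; last exact: natact_prod_moved.
by rewrite natact_prod_fixed // => u /only ->.
Qed.

(** A connected nontrivial element decomposes with a single factor, so it
    already belongs to [S]; the right-hand side does not mention [S], which
    makes [S] unique. *)
Lemma BAS_connected (R : realType) (lambda mu : 'cV[R]_r.+1) (S : set 'S_r.+1) :
  is_BAS lambda mu S ->
  S = [set s | [/\ alternation lambda mu s, s <> 1%g
                 & dynkin_connected (influence s)]].
Proof.
move=> [Salt S1 Sconn Sdec]; apply/seteqP; split=> s /=.
  by move=> Ss; split; [exact: Salt | move=> E; apply: S1; rewrite -E | exact: Sconn].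
move=> [/Sdec[T [TS ind Es]] s1 conn].
have [T0|[t tT]] := set_0Vmem T.
  by case: s1; rewrite Es T0 big_set0.
rewrite Es (connected_factor ind _ _ tT); first exact: TS.
  by move=> u /TS Su u1; apply: S1; rewrite -u1.
by rewrite -Es.
Qed.

End IndependentProducts.

(** * Partial sums and the partition function *)

Section Alternation.
Variables (R : realType) (r : nat).

Lemma sum_delta (A : pzRingType) (f : nat -> A) x n :
  \sum_(0 <= a < n) (x == a)%:R * f a = if (x < n)%N then f x else 0.
Proof.
elim: n => [|n IH]; first by rewrite big_nil.
rewrite big_nat_recr //= IH ltnS.
by case: ltngtP => [||->]; rewrite ?mul0r ?mul1r ?addr0 ?add0r.
Qed.

Lemma alphaE a b : (a <= b.+1)%N -> alpha R r a b = stdvec R r a - stdvec R r b.+1.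
Proof.
move=> ab; rewrite /alpha -[RHS]opprB -(telescope_sumr (stdvec R r) ab) -sumrN.
by apply: eq_bigr => k _; rewrite opprB.
Qed.

Lemma alpha_coord a b (x : 'I_r.+1) : (a <= b.+1)%N ->
  alpha R r a b x 0 = (x.+1 == a)%:R - (x == b :> nat)%:R.
Proof. by move=> ab; rewrite alphaE // !mxE eqSS. Qed.

Lemma sum_posroot (V : nmodType) (F : nat -> nat -> V) :
  \sum_(p : posroot r) F (val p).1 (val p).2 =
  \sum_(a < r) \sum_(b < r | (a <= b)%N) F a b.
Proof.
rewrite pair_big_dep /=.
by rewrite -(big_sub (fun p : 'I_r * 'I_r => (p.1 <= p.2)%N) (fun p => F p.1 p.2)).
Qed.

Lemma rho_coord (x : 'I_r.+1) : rho R r x 0 = r%:R / 2 - x%:R.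
Proof.
suff E : (\sum_(p : posroot r) posroot_vec R p) x 0 = r%:R - x%:R *+ 2.
  by rewrite /rho mxE E; field.
rewrite summxE.
under eq_bigr => p _ do rewrite alpha_coord ?ltnS ?(leqW (valP p)) // eqSS.
rewrite (sum_posroot (fun a b => (x == a :> nat)%:R - (x == b.+1 :> nat)%:R)).
have -> : \sum_(a < r) \sum_(b < r | (a <= b)%N)
     ((x == a :> nat)%:R - (x == b.+1 :> nat)%:R) =
   \sum_(0 <= a < r) (x == a :> nat)%:R * (r - a)%:R
   - \sum_(0 <= b < r) (x == b.+1 :> nat)%:R * b.+1%:R :> R.
  under eq_bigr => a _ do rewrite sumrB.
  rewrite sumrB !big_mkord; congr (_ - _).
    apply: eq_bigr => a _.
    by rewrite -(big_geq_mkord _ _ xpredT (fun=> _)) sumr_const_nat mulr_natr.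
  rewrite (exchange_big_dep xpredT) //=; apply: eq_bigr => b _.
  rewrite (eq_bigl (fun a : 'I_r => (a < b.+1)%N)); last by [].
  by rewrite -(big_ord_widen _ (fun=> _)) ?sumr_const ?card_ord ?mulr_natr.
rewrite sum_delta.
have -> : \sum_(0 <= b < r) (x == b.+1 :> nat)%:R * b.+1%:R = x%:R :> R.
  transitivity (\sum_(0 <= b < r.+1) (x == b :> nat)%:R * b%:R : R); last first.
    by rewrite sum_delta ltn_ord.
  by rewrite [RHS]big_nat_recl //= mulr0 add0r.
have xr := ltn_ord x; rewrite ltnS in xr.
have -> : (if (x < r)%N then (r - x)%:R else 0) = r%:R - x%:R :> R.
  by rewrite -natrB //; case: ltnP => // rx; rewrite (_ : r - x = 0)%N //; lia.
ring.
Qed.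

Lemma kostant_gt0 (xi : 'cV[R]_r.+1) :
  (0 < kostant xi)%N <-> exists c, partitions xi c.
Proof.
rewrite /kostant cardfs_gt0; split=> [/fset0Pn[c]|[c cxi]].
  by rewrite in_fset_set ?inE; [exists c | exact: finite_partitions].
by apply/fset0Pn; exists c; rewrite in_fset_set ?inE //; exact: finite_partitions.
Qed.

(** Partial sums of coordinates are the coefficients on the simple roots, which
    are positive roots themselves; so a nonnegative integral combination of
    positive roots exists as soon as they are nonnegative integers. *)
Lemma kostant_partial_sums (z : nat -> int) :
  (0 < kostant (\col_(x < r.+1) (z x)%:~R : 'cV[R]_r.+1))%N <->
  (forall m, (m <= r)%N -> 0 <= \sum_(0 <= x < m) z x) /\
  \sum_(0 <= x < r.+1) z x = 0.
Proof.
rewrite kostant_gt0; set xi := (X in partitions X); split=> [[c cE]|[Zge0 Z0]].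
  have psum m : (m <= r.+1)%N -> (\sum_(0 <= x < m) z x)%:~R =
      \sum_(p : posroot r) ((val p).1 < m <= (val p).2.+1)%N%:R *+ c p :> R.
    move=> mr; rewrite rmorph_sum /=.
    transitivity (\sum_(0 <= x < m) xi (inord x) 0).
      by apply: eq_big_nat => x xm; rewrite mxE inordK //; lia.
    rewrite -cE; under eq_bigr => x _ do rewrite summxE.
    rewrite exchange_big /=; apply: eq_bigr => p _.
    have pp := valP p.
    transitivity (\sum_(0 <= x < m)
       (((val p).1 == x :> nat)%:R * (c p)%:R - ((val p).2.+1 == x)%:R * (c p)%:R) : R).
      apply: eq_big_nat => x xm; rewrite mulmxnE alpha_coord; last by rewrite ltnS leqW.
      rewrite inordK; last by lia.
      by rewrite eqSS -mulrBl mulr_natr !(eq_sym x).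
    rewrite sumrB (sum_delta (fun=> _)) (sum_delta (fun=> _)).
    case: (ltnP (val p).1 m) => h1; case: (leqP m (val p).2.+1) => h2 /=;
      rewrite ?(mul0r, mul1r, mul0rn, subrr, subr0) //.
    by have := leq_trans h2 (leq_trans h1 pp); rewrite ltnNge leqnSn.
  split=> [m mr|].
    rewrite -(ler0z R) psum; last exact: leqW.
    by apply: sumr_ge0 => p _; rewrite mulrn_wge0 // ler0n.
  apply/eqP; rewrite -(intr_eq0 R) psum // big1 // => p _.
  case: andP => [[_ h]|_]; last by rewrite mul0rn.
  by have := leq_trans h (ltn_ord (val p).2); rewrite ltnn.
pose Z m : int := \sum_(0 <= x < m) z x.
exists [ffun p : posroot r => if (val p).1 == (val p).2 then `|Z (val p).1.+1|%N else 0%N].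
(* Only the simple roots, the pairs [(a, a)], are used. *)
rewrite /partitions /=; apply/matrixP => x y; rewrite ord1 mxE summxE.
under eq_bigr => p _ do
  rewrite ffunE mulmxnE alpha_coord ?ltnS ?(leqW (valP p)) // eqSS -val_eqE.
rewrite (sum_posroot (fun a b => ((x == a :> nat)%:R - (x == b.+1 :> nat)%:R) *+
   (if a == b then `|Z a.+1|%N else 0%N))).
transitivity ((\sum_(0 <= a < r) (x == a :> nat)%:R * Z a.+1
   - \sum_(0 <= a < r) (x == a.+1 :> nat)%:R * Z a.+1)%:~R : R).
  rewrite -sumrB rmorph_sum /= big_mkord; apply: eq_bigr => a _.
  rewrite (bigD1 a) //= eqxx big1 ?addr0 => [|b /andP[_ ba]].
    rewrite -mulrBl rmorphM rmorphB /= !natz -mulr_natr; congr (_ * _).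
    have /gez0_abs <- // : 0 <= Z a.+1 by apply: Zge0.
  by move: ba; rewrite -val_eqE /= eq_sym => /negPf->; rewrite mulr0n.
congr intmul; rewrite sum_delta.
have -> : \sum_(0 <= a < r) (x == a.+1 :> nat)%:R * Z a.+1 = Z x.
  transitivity (\sum_(0 <= a < r.+1) (x == a :> nat)%:R * Z a); last first.
    by rewrite sum_delta ltn_ord.
  by rewrite [RHS]big_nat_recl //= /Z big_nil mulr0 add0r.
have := ltn_ord x; rewrite ltnS leq_eqVlt => /orP[/eqP xr|xr].
  move: Z0; rewrite xr ltnn big_nat_recr //= -/(Z r) sub0r => /eqP.
  by rewrite addr_eq0 => /eqP->; rewrite opprK.
by rewrite xr /Z big_nat_recr //= addrAC subrr add0r.
Qed.

End Alternation.

(** * The alternation set of the highest root and a negative root *)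

Section AlternationOfRoot.
Variables (R : realType) (r i j : nat).
Hypotheses (hi : (1 < i)%N) (hij : (i <= j)%N) (hj : (j < r)%N).
Implicit Types (s : 'S_r.+1) (m n : nat).

Definition displacement s m : int :=
  \sum_(0 <= x < m) ((natact s x)%:Z - x%:Z).

Definition capacity m : int := 1 + nat_of_bool (i <= m <= j)%N.

Lemma displacementS s m :
  displacement s m.+1 = displacement s m + ((natact s m)%:Z - m%:Z).
Proof. by rewrite /displacement big_nat_recr. Qed.

Lemma displacement_full s : displacement s r.+1 = 0.
Proof.
rewrite /displacement sumrB !big_mkord.
under eq_bigr => x _ do rewrite natact_ord.
by rewrite [X in _ - X](reindex_inj (@perm_inj _ s)) subrr.
Qed.

Let coeff s n : int :=
  (natact s n == 0)%N%:Z - (natact s n == r)%N%:Z + n%:Z - (natact s n)%:Z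
  + (n.+1 == i)%N%:Z - (n == j)%N%:Z.

Lemma weyl_coord s :
  weyl_act s (highest_root R r + rho R r) - - alpha R r i j - rho R r
  = \col_(x < r.+1) (coeff s x)%:~R.
Proof.
apply/matrixP => x y; rewrite ord1 /weyl_act -row_permE.
move: (rho R r) (@rho_coord R r) => v vE.
have hE := @alpha_coord R r 1 r; have aE := @alpha_coord R r i j.
rewrite /highest_root; move: (alpha R r 1 r) (alpha R r i j) hE aE => h a hE aE.
rewrite !mxE !vE hE ?aE ?(leqW hij) // -natact_ord /coeff eqSS.
by rewrite !(intrD, rmorphN) /= -!pmulrn; ring.
Qed.

(** The cuts [1] and [r] lie outside [[i, j]], and moving an end of the segment
    would make the partial sum there negative.  Once both ends are fixed, the
    highest root contributes [1] to every partial sum with [1 <= m <= r], and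
    [- mu] contributes [1] when [i <= m <= j]. *)
Lemma alternation_displacement s :
  alternation (highest_root R r) (- alpha R r i j) s <->
  [/\ natact s 0 = 0%N, natact s r = r
    & forall m, (m <= r)%N -> displacement s m <= capacity m].
Proof.
rewrite /alternation /= weyl_coord kostant_partial_sums.
have closed : natact s 0 = 0%N -> natact s r = r -> forall m, (m < r)%N ->
    \sum_(0 <= x < m.+1) coeff s x = capacity m.+1 - displacement s m.+1.
  move=> s0 sr; elim=> [|m IH] mr.
    rewrite big_nat1 displacementS /displacement big_nil /capacity /coeff s0; lia.
  have s_m0 : natact s m.+1 <> 0%N.
    by rewrite -s0 => /natact_inj.
  have s_mr : natact s m.+1 <> r.
    by rewrite -{2}sr => /natact_inj; lia.
  rewrite big_nat_recr //= IH; last exact: ltnW.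
  rewrite [in RHS]displacementS /capacity /coeff; lia.
split=> [[psum total]|[s0 sr bound]].
  have s0 : natact s 0 = 0%N.
    have := psum 1%N; rewrite big_nat1 /coeff; lia.
  have sr : natact s r = r.
    have := psum r (leqnn r); move: total; rewrite big_nat_recr //=.
    have : (natact s r <= r)%N by rewrite natact_le.
    by move: (\sum_(_ <= _ < _) _) => Z; rewrite /coeff; lia.
  split=> // -[|m] mr; first by rewrite /displacement big_nil /capacity; lia.
  by rewrite -subr_ge0 -closed // psum.
split=> [[|m] mr|]; first by rewrite big_nil.
  by rewrite closed // subr_ge0 bound.
have r1 : r = r.-1.+1 by lia.
have := displacement_full s.
rewrite big_nat_recr //= displacementS sr [in \sum_(_ <= _ < _) _]r1 closed //; last lia.
rewrite -r1 /capacity /coeff sr; lia.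
Qed.

End AlternationOfRoot.

(** * The five block patterns *)

Definition swap a u : nat := if u == a then a.+1 else if u == a.+1 then a else u.

(** Each word in the translated reflections is paired with the one-line notation
    of its product on the block. *)
Definition basic_patterns : seq (seq nat * seq nat) :=
  [:: ([:: 0], [:: 1; 0]); ([:: 1; 0], [:: 1; 2; 0]); ([:: 0; 1], [:: 2; 0; 1]);
      ([:: 0; 1; 0], [:: 2; 1; 0]); ([:: 2; 0; 1], [:: 2; 0; 3; 1])]%N.

Definition pattern_displacement (p : seq nat) t : int :=
  (sumn (take t p))%:Z - (sumn (iota 0 t))%:Z.

Lemma pattern_displacementS p t : (t < size p)%N ->
  pattern_displacement p t.+1 = pattern_displacement p t + ((nth 0%N p t)%:Z - t%:Z).
Proof.
move=> tp; rewrite /pattern_displacement (take_nth 0%N tp) sumn_rcons.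
by rewrite -addn1 iotaD sumn_cat /=; lia.
Qed.

(** The fourth clause says that every inner cut of the block is crossed, and the
    last one that the block is closed. *)
Lemma basic_patterns_facts (w p : seq nat) : (w, p) \in basic_patterns ->
  [/\ (1 < size p)%N, all (fun a => a.+1 < size p)%N w,
      all (fun u => u < size p)%N p,
      all (fun t => has (fun u => t <= nth 0 p u) (iota 0 t))%N (iota 1 (size p).-1)
    & pattern_displacement p (size p) = 0].
Proof. by rewrite !inE => /or4P[||| /orP[]] /eqP[-> ->]. Qed.

Section Blocks.
Variable r : nat.
Implicit Types (s : 'S_r.+1) (w p : seq nat) (m n k u : nat).

Definition sword n w : 'S_r.+1 := (\prod_(a <- w) srefl r (n + a).+1)%g.

Definition is_block s n p : Prop := forall m,
  natact s m = if (n <= m < n + size p)%N then (n + nth 0 p (m - n))%N else m.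

Lemma natact_sword n w m : all (fun a => n + a < r)%N w ->
  natact (sword n w) m =
  if (m < n)%N then m else (n + foldl (fun u a => swap a u) (m - n) w)%N.
Proof.
rewrite /sword; elim: w m => [|a w IH] m /=.
  by rewrite big_nil natact1 => _; case: ltnP => // /subnKC.
move=> /andP[ar wr]; rewrite big_cons natactM IH // natact_srefl; last first.
  by rewrite /vertex; lia.
rewrite /swap; case: (ltnP m n) => mn.
  by do 2?[case: eqP => ?]; try lia; rewrite mn.
have -> : (m == (n + a).+1.-1) = (m - n == a)%N by lia.
have -> : (m == (n + a).+1) = (m - n == a.+1)%N by lia.
case: eqP => _; first by rewrite ltnNge -addnS leq_addr addKn.
case: eqP => _; first by rewrite /= ltnNge leq_addr addKn.
by rewrite ltnNge mn.
Qed.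

Lemma sword_block n w p : (w, p) \in basic_patterns -> (n + size p <= r.+1)%N ->
  is_block (sword n w) n p.
Proof.
move=> wp npr m; have [_ wsp _ _ _] := basic_patterns_facts wp.
rewrite natact_sword; last first.
  by apply/allP => a /(allP wsp) /=; lia.
case: (ltnP m n) => mn //=.
rewrite -(subnKC mn) ltn_add2l addKn.
move: (m - n)%N => u; move: wp {wsp npr}.
by rewrite !inE => /or4P[||| /orP[]] /eqP[-> ->]; case: u => [|[|[|[|u]]]].
Qed.

Lemma block_inj s s' n p : is_block s n p -> is_block s' n p -> s = s'.
Proof. by move=> sb sb'; apply: eq_natact => m; rewrite sb sb'. Qed.

Lemma block_fixed s n p m : is_block s n p ->
  (m < n)%N || (n + size p <= m)%N -> natact s m = m.
Proof. by move=> sb h; rewrite sb ifN //; lia. Qed.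

Lemma block_crosses s n w p k : (w, p) \in basic_patterns -> is_block s n p ->
  crosses s k <-> (n < k < n + size p)%N.
Proof.
move=> wp sb; have [_ _ psz pind _] := basic_patterns_facts wp.
split=> [[m mk]|/andP[nk kp]].
  rewrite sb; case: ifP => [/andP[nm mp]|]; last lia.
  have mnp : (m - n < size p)%N by lia.
  by have /(allP psz) /= := mem_nth 0%N mnp; lia.
have : (k - n)%N \in iota 1 (size p).-1 by rewrite mem_iota; lia.
move=> /(allP pind) /hasP[u]; rewrite mem_iota /= add0n => uk ku.
exists (n + u)%N; first lia.
rewrite sb ifT; last lia.
by rewrite addKn; lia.
Qed.

Lemma interval_connected (K : set nat) lo hi :
  (forall k, K k <-> (lo < k < hi)%N) -> dynkin_connected K.
Proof.
move=> KE.
have up d a : (lo < a)%N -> (a + d < hi)%N -> exists p,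
    [/\ path dynkin_edge a p, last a p = (a + d)%N & forall c, c \in p -> K c].
  elim: d a => [|d IH] a la ah; first by exists [::]; rewrite addn0.
  have [||p [pp lp pK]] := IH a.+1; try lia.
  exists (a.+1 :: p); split; rewrite /= ?lp ?addSnnS //.
    by rewrite pp /dynkin_edge eqxx.
  by move=> c; rewrite inE => /orP[/eqP->|/pK//]; apply/KE; lia.
have down d a : (lo < a)%N -> (a + d < hi)%N -> exists p,
    [/\ path dynkin_edge (a + d)%N p, last (a + d)%N p = a & forall c, c \in p -> K c].
  elim: d a => [|d IH] a la ah; first by exists [::]; rewrite addn0.
  have [||p [pp lp pK]] := IH a; try lia.
  exists ((a + d)%N :: p); split; rewrite /= ?lp //.
    by rewrite pp /dynkin_edge addnS eqxx orbT.
  by move=> c; rewrite inE => /orP[/eqP->|/pK//]; apply/KE; lia.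
move=> a b /KE /andP[la ah] /KE /andP[lb bh].
have [ab|ba] := leqP a b.
  by rewrite -(subnKC ab); apply: up; lia.
by rewrite -(subnKC (ltnW ba)); apply: down; lia.
Qed.

Lemma block_connected s n w p : (w, p) \in basic_patterns -> is_block s n p ->
  dynkin_connected (influence s).
Proof.
move=> wp sb; apply: (@interval_connected _ n (n + size p)) => k.
by rewrite influenceE (block_crosses _ wp sb).
Qed.

Lemma block_displacement s n p m : is_block s n p ->
  displacement s m = pattern_displacement p (minn (m - n) (size p)).
Proof.
move=> sb; elim: m => [|m IH].
  by rewrite sub0n min0n /displacement big_nil /pattern_displacement take0.
rewrite displacementS IH sb; case: ifP => h.
  have -> : minn (m.+1 - n) (size p) = (m - n).+1 by lia.
  have -> : minn (m - n) (size p) = (m - n)%N by lia.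
  by rewrite pattern_displacementS; lia.
have -> : minn (m.+1 - n) (size p) = minn (m - n) (size p) by lia.
by rewrite subrr addr0.
Qed.

Lemma displacement_block_prefix s n p t :
  (forall m, (m < n)%N -> natact s m = m) ->
  (forall u, (u < size p)%N -> natact s (n + u) = (n + nth 0 p u)%N) ->
  (t <= size p)%N -> displacement s (n + t) = pattern_displacement p t.
Proof.
move=> fixn sp; elim: t => [|t IH] tp.
  rewrite addn0 /displacement /pattern_displacement take0 subrr big1_seq // => x.
  by rewrite mem_index_iota => /andP[_ /andP[_ /fixn->]]; rewrite subrr.
rewrite addnS displacementS IH ?(ltnW tp) // pattern_displacementS // sp //; lia.
Qed.

End Blocks.

(** * Cutting an element of the alternation set into blocks *)

Section Decomposition.
Variables (R : realType) (r i j : nat).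
Hypotheses (hi : (1 < i)%N) (hij : (i <= j)%N) (hj : (j < r)%N).
Implicit Types (s b : 'S_r.+1) (w p : seq nat) (m n k u : nat).

Local Notation alt := (alternation (highest_root R r) (- alpha R r i j)).
Local Notation altE := (alternation_displacement R hi hij hj).

(** The displacement bound read off on a block placed at position [n], together
    with the requirement that it avoid the two fixed ends. *)
Definition admissible n p : Prop :=
  [/\ (0 < n)%N, (n + size p <= r)%N
    & forall t, (t <= size p)%N -> pattern_displacement p t <= capacity i j (n + t)].

Definition basic_allowable s : Prop :=
  exists n w p, [/\ (w, p) \in basic_patterns, admissible n p & s = sword r n w].

Lemma capacity_ge0 m : 0 <= capacity i j m.
Proof. by rewrite /capacity; case: (_ && _). Qed.

Lemma admissible_alternation s n w p : (w, p) \in basic_patterns ->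
  admissible n p -> is_block s n p -> alt s.
Proof.
move=> wp [n0 npr bound] sb; apply/altE.
have [_ _ _ _ p0] := basic_patterns_facts wp.
have fixs m : (m < n)%N || (n + size p <= m)%N -> natact s m = m by exact: block_fixed.
split=> [||m mr]; [by apply: fixs; rewrite n0 | by apply: fixs; rewrite npr orbT |].
rewrite (block_displacement _ sb).
have [mn|nm] := leqP m n.
  have -> : minn (m - n) (size p) = 0%N by lia.
  by rewrite {1}/pattern_displacement take0 subrr capacity_ge0.
have [mp|pm] := leqP m (n + size p).
  have -> : minn (m - n) (size p) = (m - n)%N by lia.
  by rewrite -{2}(subnKC (ltnW nm)) bound //; lia.
have -> : minn (m - n) (size p) = size p by lia.
by rewrite p0 capacity_ge0.
Qed.

(** The values below [n] are taken, so the displacement bound [2] leaves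
    [n + 1] and [n + 2] for the first value; the bound and
    injectivity then leave at most two values at each later position.
    As [r] is fixed, the block closes before reaching it. *)
Lemma first_block s n : alt s -> (forall m, (m < n)%N -> natact s m = m) ->
  natact s n <> n -> exists w p, [/\ (w, p) \in basic_patterns, admissible n p
    & forall u, (u < size p)%N -> natact s (n + u) = (n + nth 0 p u)%N].
Proof.
move=> /altE[s0 sr bound] fixn sn.
have n0 : (0 < n)%N by case: n sn {fixn} => // /(_ s0).
have nr : (n < r)%N.
  rewrite ltnNge; apply/negP => rn; apply: sn; move: rn.
  by rewrite leq_eqVlt => /orP[/eqP<-//|rn]; apply: natact_out.
suff [w [p [wp npr sp]]] : exists w p, [/\ (w, p) \in basic_patterns,
    (n + size p <= r)%N
    & forall u, (u < size p)%N -> natact s (n + u) = (n + nth 0 p u)%N].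
  exists w, p; split=> //; split=> // t tp.
  rewrite -(displacement_block_prefix fixn sp tp); apply: bound; lia.
have disp0 : displacement s n = 0.
  by rewrite -(addn0 n) (@displacement_block_prefix _ _ _ [::] 0).
have cap2 m : capacity i j m <= 2 by rewrite /capacity; lia.
have ge m : (n <= m)%N -> (n <= natact s m)%N.
  by move=> nm; rewrite leqNgt; apply/negP => lt; have /natact_inj := fixn _ lt; lia.
have bnd m : (m < r)%N -> displacement s m + (natact s m)%:Z - m%:Z <= 2.
  move=> mr; rewrite -addrA -displacementS.
  exact: le_trans (bound _ mr) (cap2 _).
have neq m k : (m != k)%N -> natact s m != natact s k.
  by rewrite (inj_eq (@natact_inj r s)).
have ne_r m : (m < r)%N -> natact s m != r.
  by move=> mr; rewrite -[X in _ != X]sr; apply: neq; lia.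
have b0 := bnd n nr; have g0 := ge n (leqnn n).
have le_r m : (m < r)%N -> (natact s m < r)%N.
  by move=> mr; rewrite ltn_neqAle ne_r // natact_le ltnW.
have l0 := le_r n nr.
have [E0|E0] : natact s n = n.+1 \/ natact s n = n.+2 by lia.
- (* The value [n + 1] comes first: patterns 10 and 120. *)
  have n1r : (n.+1 < r)%N by lia.
  have b1 := bnd _ n1r; have g1 := ge n.+1 (leqnSn n); have l1 := le_r _ n1r.
  rewrite displacementS disp0 in b1.
  have q1 := neq n n.+1.
  have [E1|E1] : natact s n.+1 = n \/ natact s n.+1 = n.+2 by lia.
    exists [:: 0%N], [:: 1; 0]%N; split=> //=; first lia.
    by move=> [|[|u]] //= _; rewrite ?addn0 ?addn1.
  have n2r : (n.+2 < r)%N by lia.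
  have b2 := bnd _ n2r; have g2 := ge n.+2 (leqW (leqnSn n)).
  rewrite !displacementS disp0 in b2.
  have q2 := neq n n.+2; have q3 := neq n.+1 n.+2.
  exists [:: 1; 0]%N, [:: 1; 2; 0]%N; split=> //=; first lia.
  by move=> [|[|[|u]]] //= _; rewrite ?addn0 ?addn1 ?addn2 //; lia.
(* The value [n + 2] comes first: patterns 201, 2031 and 210. *)
have n2r : (n.+2 < r)%N by lia.
have n1r : (n.+1 < r)%N by lia.
have b1 := bnd _ n1r; have g1 := ge n.+1 (leqnSn n).
rewrite displacementS disp0 in b1.
have q1 := neq n n.+1.
have b2 := bnd _ n2r; have g2 := ge n.+2 (leqW (leqnSn n)); have l2 := le_r _ n2r.
rewrite !displacementS disp0 in b2.
have q2 := neq n n.+2; have q3 := neq n.+1 n.+2.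
have [E1|E1] : natact s n.+1 = n \/ natact s n.+1 = n.+1 by lia.
  have [E2|E2] : natact s n.+2 = n.+1 \/ natact s n.+2 = n.+3 by lia.
    exists [:: 0; 1]%N, [:: 2; 0; 1]%N; split=> //=; first lia.
    by move=> [|[|[|u]]] //= _; rewrite ?addn0 ?addn1 ?addn2 //; lia.
  have n3r : (n.+3 < r)%N by lia.
  have b3 := bnd _ n3r; have g3 := ge n.+3 (leqW (leqW (leqnSn n))).
  rewrite !displacementS disp0 in b3.
  have q4 := neq n n.+3; have q5 := neq n.+1 n.+3; have q6 := neq n.+2 n.+3.
  exists [:: 2; 0; 1]%N, [:: 2; 0; 3; 1]%N; split=> //=; first lia.
  by move=> [|[|[|[|u]]]] //= _; rewrite ?addn0 ?addn1 ?addn2 ?addn3 //; lia.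
exists [:: 0; 1; 0]%N, [:: 2; 1; 0]%N; split=> //=; first lia.
by move=> [|[|[|u]]] //= _; rewrite ?addn0 ?addn1 ?addn2 //; lia.
Qed.

(** Since [s] agrees with the block [b] up to its end and the block has total
    displacement [0], the quotient has displacement [0] up to there and that
    of [s] afterwards. *)
Lemma peel_block s b n p : is_block b n p -> (n + size p <= r)%N ->
  pattern_displacement p (size p) = 0 ->
  (forall m, (m < n)%N -> natact s m = m) ->
  (forall u, (u < size p)%N -> natact s (n + u) = (n + nth 0 p u)%N) ->
  (forall m, (m < n + size p)%N -> natact (b^-1 * s)%g m = m) /\
  (alt s -> alt (b^-1 * s)%g).
Proof.
set N := (n + size p)%N.
move=> bb Nr p0 fixn sp.
have sb m : (m < N)%N -> natact s m = natact b m.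
  move=> mN; rewrite bb mN andbT; case: leqP => [nm|/fixn//].
  by rewrite -{1}(subnKC nm) sp //; lia.
have bN m : (N <= m)%N -> natact b m = m.
  by move=> Nm; apply: block_fixed bb _; rewrite Nm orbT.
have fixN m : (m < N)%N -> natact (b^-1 * s)%g m = m.
  move=> mN; rewrite natactM sb ?natactKV // ltnNge; apply/negP => Nq.
  by have := bN _ Nq; rewrite natactKV => E; move: Nq; rewrite -E; lia.
have outN m : (N <= m)%N -> natact (b^-1 * s)%g m = natact s m.
  by move=> Nm; rewrite natactM natactV_fix // bN.
split=> // /altE[s0 sr bound]; apply/altE; split=> [||m mr].
- by have [/fixN//|/outN->] := ltnP 0 N.
- by rewrite outN.
have disp_le k : (k <= N)%N -> displacement (b^-1 * s)%g k = 0.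
  move=> kN; rewrite -(add0n k) (@displacement_block_prefix _ _ 0 (iota 0 k)) ?size_iota //.
    by rewrite /pattern_displacement take_oversize ?size_iota // subrr.
  by move=> u uk; rewrite nth_iota // fixN //; lia.
have [/disp_le->|Nm] := leqP m N; first exact: capacity_ge0.
suff <- : displacement s m = displacement (b^-1 * s)%g m by exact: bound.
rewrite -(subnKC (ltnW Nm)); elim: (m - N)%N => [|d IH].
  by rewrite addn0 disp_le // (displacement_block_prefix fixn sp).
by rewrite addnS !displacementS IH outN // leq_addr.
Qed.

Lemma basic_allowable_block s : basic_allowable s <-> exists n w p,
  [/\ (w, p) \in basic_patterns, admissible n p & is_block s n p].
Proof.
split=> -[n [w [p [wp adm E]]]]; exists n, w, p; split=> //; have [_ npr _] := adm.
  by rewrite E; apply: sword_block => //; exact: leqW.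
by apply: block_inj E _; apply: sword_block => //; exact: leqW.
Qed.

(** Induction on the number of positions not yet known to be fixed, peeling off
    the leftmost block.  The remaining factors fix everything up to the end of
    that block, so their influences start beyond its extended influence. *)
Lemma allowable_decomposition s : alt s -> exists T : {set 'S_r.+1},
  [/\ forall t, t \in T -> basic_allowable t, pairwise_independent T
    & s = (\prod_(t in T) t)%g].
Proof.
move=> salt.
suff H d n : (r <= n + d)%N -> forall s, alt s -> (forall m, (m < n)%N -> natact s m = m) ->
    exists T : {set 'S_r.+1},
    [/\ forall t, t \in T -> basic_allowable t, pairwise_independent T,
       s = (\prod_(t in T) t)%g
     & forall t m, t \in T -> (m < n)%N -> natact t m = m].
  by have [//|T [TB ind Es _]] := H r 0%N (leqnn r) s salt; exists T.
elim: d n => [|d IH] n rnd {}s {}salt fixn.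
  exists finset.set0; split=> [t|t|//|t m]; rewrite ?inE //.
  rewrite big_set0; apply: eq_natact => m; rewrite natact1.
  have [/fixn//|nm] := ltnP m n.
  have [_ sr _] := (altE s).1 salt.
  have [->//|rm] := eqVneq m r; apply: natact_out; lia.
have [sn|/eqP sn] := eqVneq (natact s n) n.
  have [||T [TB ind Es fixT]] := IH n.+1 _ s salt; first lia.
    by move=> m; rewrite ltnS leq_eqVlt => /orP[/eqP->|/fixn].
  by exists T; split=> // t m tT mn; apply: fixT; rewrite // ltnW.
have [w [p [wp adm sp]]] := first_block salt fixn sn.
have [n0 npr _] := adm; have [p2 _ _ _ p0] := basic_patterns_facts wp.
set b := sword r n w.
have bb : is_block b n p by apply: sword_block => //; exact: leqW.
have [fixN altN] := peel_block bb npr p0 fixn sp.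
have [|T [TB ind Es fixT]] := IH (n + size p)%N _ _ (altN salt) fixN; first lia.
have bcr k := block_crosses k wp bb.
have Tcr t k : t \in T -> crosses t k -> (n + size p < k)%N.
  move=> tT [m mk kt]; apply: (leq_ltn_trans _ mk); rewrite leqNgt; apply/negP => mN.
  by move: kt; rewrite (fixT _ _ tT mN) leqNgt mk.
have ind' : pairwise_independent (b |: T)%SET.
  move=> t u; rewrite !inE => /orP[/eqP->|tT] /orP[/eqP->|uT] tu.
  - by rewrite eqxx in tu.
  - rewrite /independent -subset0 => k [/influenceE /bcr k1 [_]].
    by case=> /influenceE /(Tcr _ _ uT); lia.
  - rewrite /independent -subset0 => k [/influenceE /(Tcr _ _ tT) k1 [_]].
    by case=> /influenceE /bcr; lia.
  exact: ind.
exists (b |: T)%SET; split=> //.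
- move=> t; rewrite !inE => /orP[/eqP->|/TB//].
  by exists n, w, p.
- have -> : s = (b * \prod_(t in T) t)%g by rewrite -Es mulKVg.
  apply: eq_natact => m; rewrite natactM.
  have [mv|bm] := boolP (natact b m != m).
    rewrite (natact_prod_moved ind' _ mv) ?setU11 //.
    apply: natact_prod_fixed => t tT; apply: fixT => //.
    move: mv; apply: contra_neqT; rewrite -leqNgt => Nbm.
    by apply: (@natact_inj _ b); apply: block_fixed bb _; rewrite Nbm orbT.
  move: bm; rewrite negbK => /eqP bm; rewrite bm.
  have [[t tT mv]|nomove] := pselect (exists2 t, t \in T & natact t m != m).
    by rewrite (natact_prod_moved ind tT mv) (natact_prod_moved ind' _ mv) // inE tT orbT.
  have fixm t : t \in T -> natact t m = m.
    by move=> tT; apply/eqP; apply: contrapT => /negP mv; apply: nomove; exists t.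
  rewrite !natact_prod_fixed // => t; rewrite !inE => /orP[/eqP->//|]; exact: fixm.
move=> t m; rewrite !inE => /orP[/eqP->|tT] mn; last by apply: fixT => //; lia.
by apply: block_fixed bb _; rewrite mn.
Qed.

Lemma basic_allowable_BAS :
  is_BAS (highest_root R r) (- alpha R r i j) [set s | basic_allowable s].
Proof.
split.
- move=> s /basic_allowable_block[n [w [p [wp adm sb]]]].
  exact: (admissible_alternation wp adm sb).
- move=> /basic_allowable_block[n [w [p [wp adm sb]]]].
  have [p2 _ _ _ _] := basic_patterns_facts wp.
  have [|m mn] := (block_crosses n.+1 wp sb).2; first lia.
  by rewrite natact1; lia.
- by move=> s /basic_allowable_block[n [w [p [wp _ sb]]]]; exact: (block_connected wp sb).
exact: allowable_decomposition.
Qed.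

(** Here [k = n + 1].  The capacity is at least [1], so the bound is a
    restriction only at the cuts where the pattern has displacement [2], which
    must lie in [[i, j]]; the other limits on [k] keep the block away from the
    two ends. *)
Lemma basic_allowable_explicit :
  [set s | basic_allowable s] =
  [set srefl r k | k in [set k : nat | (1 < k < r)%N]]
     `|` [set (srefl r k.+1 * srefl r k)%g
           | k in [set k : nat | (maxn (i - 1) 2 <= k <= j - 1)%N]]
     `|` [set (srefl r k * srefl r k.+1)%g
           | k in [set k : nat | (i <= k <= minn j (r - 2))%N]]
     `|` [set (srefl r k * srefl r k.+1 * srefl r k)%g
           | k in [set k : nat | (i <= k <= j - 1)%N]]
     `|` [set (srefl r k.+2 * srefl r k * srefl r k.+1)%g
           | k in [set k : nat | (i <= k <= j - 2)%N]].
Proof.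
have swE n : [/\ sword r n [:: 0%N] = srefl r n.+1,
    sword r n [:: 1; 0]%N = (srefl r n.+2 * srefl r n.+1)%g,
    sword r n [:: 0; 1]%N = (srefl r n.+1 * srefl r n.+2)%g,
    sword r n [:: 0; 1; 0]%N = (srefl r n.+1 * srefl r n.+2 * srefl r n.+1)%g
  & sword r n [:: 2; 0; 1]%N = (srefl r n.+3 * srefl r n.+1 * srefl r n.+2)%g].
  by rewrite /sword !(big_cons, big_nil) /= !mulg1 !addn0 !addn1 !addn2 !mulgA.
apply/seteqP; split=> s.
  move=> [n [w [p [+ [n0 npr bound] ->]]]]; have [e1 e2 e3 e4 e5] := swE n.
  rewrite !inE => /or4P[||| /orP[]] /eqP[Ew Ep];
    move: npr bound; rewrite Ew Ep /= => npr bound.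
  - by do 4!left; exists n.+1; rewrite ?e1 //=; lia.
  - do 3!left; right; exists n.+1; rewrite ?e2 //=.
    have := bound 2%N isT; rewrite /capacity /pattern_displacement /=; lia.
  - do 2!left; right; exists n.+1; rewrite ?e3 //=.
    have := bound 1%N isT; rewrite /capacity /pattern_displacement /=; lia.
  - left; right; exists n.+1; rewrite ?e4 //=.
    have := bound 1%N isT; have := bound 2%N isT.
    rewrite /capacity /pattern_displacement /=; lia.
  - right; exists n.+1; rewrite ?e5 //=.
    have := bound 1%N isT; have := bound 3%N isT.
    rewrite /capacity /pattern_displacement /=; lia.
move=> [[[[|]|]|]|] [[|n] /= kP <-]; try lia; have [e1 e2 e3 e4 e5] := swE n.
- exists n, [:: 0]%N, [:: 1; 0]%N; split=> //; split=> /=; try lia.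
  by case=> [|[|[|t]]] // _; rewrite /capacity /pattern_displacement /=; lia.
- exists n, [:: 1; 0]%N, [:: 1; 2; 0]%N; split=> //; split=> /=; try lia.
  by case=> [|[|[|[|t]]]] // _; rewrite /capacity /pattern_displacement /=; lia.
- exists n, [:: 0; 1]%N, [:: 2; 0; 1]%N; split=> //; split=> /=; try lia.
  by case=> [|[|[|[|t]]]] // _; rewrite /capacity /pattern_displacement /=; lia.
- exists n, [:: 0; 1; 0]%N, [:: 2; 1; 0]%N; split=> //; split=> /=; try lia.
  by case=> [|[|[|[|t]]]] // _; rewrite /capacity /pattern_displacement /=; lia.
- exists n, [:: 2; 0; 1]%N, [:: 2; 0; 3; 1]%N; split=> //; split=> /=; try lia.
  by case=> [|[|[|[|[|t]]]]] // _; rewrite /capacity /pattern_displacement /=; lia.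
Qed.

End Decomposition.

Theorem corollary4p11 (R : realType) (r i j : nat)
    (hi : (1 < i)%N) (hij : (i <= j)%N) (hj : (j < r)%N) :
  unique (@is_BAS R r (highest_root R r) (- alpha R r i j))
    ([set srefl r k | k in [set k : nat | (1 < k < r)%N]]
     `|` [set (srefl r k.+1 * srefl r k)%g
           | k in [set k : nat | (maxn (i - 1) 2 <= k <= j - 1)%N]]
     `|` [set (srefl r k * srefl r k.+1)%g
           | k in [set k : nat | (i <= k <= minn j (r - 2))%N]]
     `|` [set (srefl r k * srefl r k.+1 * srefl r k)%g
           | k in [set k : nat | (i <= k <= j - 1)%N]]
     `|` [set (srefl r k.+2 * srefl r k * srefl r k.+1)%g
           | k in [set k : nat | (i <= k <= j - 2)%N]]).
Proof.
rewrite -(basic_allowable_explicit hi hij hj).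
split=> [|S BAS_S]; first exact: basic_allowable_BAS.
by rewrite (BAS_connected BAS_S) (BAS_connected (basic_allowable_BAS R hi hij hj)).
Qed.
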